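(* Let $\boldsymbol{u}_T(\boldsymbol{m})$ be the exact terminal solution at a parameter $\boldsymbol{m}$, let $\widetilde{\boldsymbol{u}}_T(\boldsymbol{m})$ be an approximation satisfying $\|\boldsymbol{u}_T(\boldsymbol{m})-\widetilde{\boldsymbol{u}}_T(\boldsymbol{m})\|\leq\epsilon_{\rm app}$, and let $\boldsymbol{u}_{\rm obs}$ be the observation vector. Then the exact physical loss $\mathcal L_{\rm phys}(\boldsymbol{m})$ and its infinite-shot quantum approximation $\widetilde{\mathcal L}_{\rm phys}(\boldsymbol{m})$ satisfy $$\left|\mathcal L_{\rm phys}(\boldsymbol{m})-\widetilde{\mathcal L}_{\rm phys}(\boldsymbol{m})\right|\leq 2\,\|\boldsymbol{u}_T(\boldsymbol{m})-\boldsymbol{u}_{\rm obs}\|\,\epsilon_{\rm app}+\epsilon_{\rm app}^2 .$$ If, in addition, $\|\boldsymbol{u}_T(\boldsymbol{m})-\boldsymbol{u}_{\rm obs}\|\leq\delta\,\|\boldsymbol{u}_{\rm obs}\|$ for some $0<\delta<1$, then $$\left|\mathcal L_{\rm phys}(\boldsymbol{m})-\widetilde{\mathcal L}_{\rm phys}(\boldsymbol{m})\right|\leq 2\delta\,\|\boldsymbol{u}_{\rm obs}\|\,\epsilon_{\rm app}+\epsilon_{\rm app}^2 .$$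
   Context: Here $n_x\geq 1$ is an integer, $\boldsymbol{u}_{\rm obs},\boldsymbol{u}_T(\boldsymbol{m})\in\mathbb{R}^{n_x}\subset\mathbb{C}^{n_x}$ with $\boldsymbol{u}_{\rm obs}\neq0$, and $\widetilde{\boldsymbol{u}}_T(\boldsymbol{m})\in\mathbb{C}^{n_x}$ (real or complex). $\|\cdot\|$ is the Euclidean norm, $\langle\cdot,\cdot\rangle$ the standard Hermitian inner product, and $\epsilon_{\rm app}\geq0$. The vector $\boldsymbol{u}_T(\boldsymbol{m})$ is the vector of values at the grid points, at terminal time $T$, of the solution of an evolution PDE with parameter $\boldsymbol{m}$ and initial data vector $\boldsymbol{u}_0\ne 0$, and $\widetilde{\boldsymbol{u}}_T(\boldsymbol{m})$ is the approximation encoded by a quantum PDE solver. The exact physical loss is $\mathcal L_{\rm phys}(\boldsymbol{m})=\|\boldsymbol{u}_T(\boldsymbol{m})-\boldsymbol{u}_{\rm obs}\|^2$. The infinite-shot physical loss is $$\widetilde{\mathcal L}_{\rm phys}(\boldsymbol{m})=\lambda(\boldsymbol{m})^2\|\boldsymbol{u}_0\|^2\,p_{\rm succ}(\boldsymbol{m})+\|\boldsymbol{u}_{\rm obs}\|^2-2\lambda(\boldsymbol{m})\|\boldsymbol{u}_0\|\,\|\boldsymbol{u}_{\rm obs}\|\,\bigl(2p_H^u(\boldsymbol{m})-1\bigr),$$ where $\lambda(\boldsymbol{m})>0$ is a solver-dependent scaling factor with $\|\widetilde{\boldsymbol{u}}_T(\boldsymbol{m})\|\le\lambda(\boldsymbol{m})\|\boldsymbol{u}_0\|$,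 and the two probabilities (success probability of the solver and Hadamard-test probability) are $$p_{\rm succ}(\boldsymbol{m})=\frac{\|\widetilde{\boldsymbol{u}}_T(\boldsymbol{m})\|^2}{\lambda(\boldsymbol{m})^2\|\boldsymbol{u}_0\|^2},\qquad 2p_H^u(\boldsymbol{m})-1=\frac{\mathrm{Re}\langle\boldsymbol{u}_{\rm obs},\widetilde{\boldsymbol{u}}_T(\boldsymbol{m})\rangle}{\lambda(\boldsymbol{m})\|\boldsymbol{u}_0\|\,\|\boldsymbol{u}_{\rm obs}\|}.$$ Equivalently, $\widetilde{\mathcal L}_{\rm phys}(\boldsymbol{m})=\|\widetilde{\boldsymbol{u}}_T(\boldsymbol{m})-\boldsymbol{u}_{\rm obs}\|^2$. *)

(* Defs.v *)
From mathcomp Require Import all_boot all_order all_algebra.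
From mathcomp Require Import sesquilinear spectral.
From mathcomp Require Import reals.
From mathcomp Require Import complex.

Set Implicit Arguments.
Unset Strict Implicit.
Unset Printing Implicit Defensive.

Import Order.TTheory GRing.Theory Num.Theory.
Local Open Scope ring_scope.
Local Open Scope complex_scope.

Section Losses.
Variable R : realType.

(* The inclusion of R^n into C^n. *)
Definition toC n (u : 'rV[R]_n) : 'rV[R[i]]_n := map_mx (real_complex R) u.

(* The real part of the standard Hermitian inner product. [dotmx] is linear in
   its first argument; the opposite convention has the same real part. *)
Definition re_dot n (u v : 'rV[R[i]]_n) : R := complex.Re (dotmx u v).

(* The Euclidean norm on C^n, as an element of R (the norm on matrices in
   MathComp-Analysis is the sup norm). *)
Definition l2norm n (u : 'rV[R[i]]_n) : R := Num.sqrt (re_dot u u).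

Definition phys_loss n (uT uobs : 'rV[R]_n) : R :=
  l2norm (toC uT - toC uobs) ^+ 2.

Definition succ_prob n n0 (lambda : R) (u0 : 'rV[R[i]]_n0)
    (ut : 'rV[R[i]]_n) : R :=
  l2norm ut ^+ 2 / (lambda ^+ 2 * l2norm u0 ^+ 2).

(* Solved for p in
   2 p - 1 = Re <uobs, ut> / (lambda |u0| |uobs|), see [hadamard_probE]. *)
Definition hadamard_prob n n0 (lambda : R) (u0 : 'rV[R[i]]_n0)
    (uobs : 'rV[R]_n) (ut : 'rV[R[i]]_n) : R :=
  (1 + re_dot (toC uobs) ut
       / (lambda * l2norm u0 * l2norm (toC uobs))) / 2.

Lemma hadamard_probE n n0 (lambda : R) (u0 : 'rV[R[i]]_n0)
    (uobs : 'rV[R]_n) (ut : 'rV[R[i]]_n) :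
  2 * hadamard_prob lambda u0 uobs ut - 1 =
  re_dot (toC uobs) ut / (lambda * l2norm u0 * l2norm (toC uobs)).
Proof. by rewrite mulrC divfK ?pnatr_eq0// addrC addKr. Qed.

Definition infinite_shot_loss n n0 (lambda : R) (u0 : 'rV[R[i]]_n0)
    (uobs : 'rV[R]_n) (ut : 'rV[R[i]]_n) : R :=
  lambda ^+ 2 * l2norm u0 ^+ 2 * succ_prob lambda u0 ut
  + l2norm (toC uobs) ^+ 2
  - 2 * lambda * l2norm u0 * l2norm (toC uobs)
      * (2 * hadamard_prob lambda u0 uobs ut - 1).

End Losses.

(* Main.v *)
(* The Hadamard-test term linearizes Re <uobs, ut>, so the infinite-shot loss
   is |ut - uobs|^2. With a = uT - uobs and d = uT - ut, the difference of the
   losses is |a|^2 - |a - d|^2 = 2 Re <a, d> - |d|^2, and Cauchy-Schwarz bounds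
   the cross term. *)
Require Import Defs.
From mathcomp Require Import all_boot all_order all_algebra.
From mathcomp Require Import sesquilinear spectral.
From mathcomp Require Import reals.
From mathcomp Require Import complex.
From mathcomp Require Import ring.

Set Implicit Arguments.
Unset Strict Implicit.

Import Order.TTheory GRing.Theory Num.Theory.
Local Open Scope ring_scope.
Local Open Scope complex_scope.

Lemma re_dotBl (R : realType) n (u v w : 'rV[R[i]]_n) :
  re_dot (u - v) w = re_dot u w - re_dot v w.
Proof. by rewrite /re_dot linearBl raddfB. Qed.

(** Swapping the arguments of [dotmx] conjugates it, and conjugation leaves the real part unchanged;
    checked coordinate by coordinate. *)
Lemma re_dotC (R : realType) n (u v : 'rV[R[i]]_n) : re_dot u v = re_dot v u.
Proof.
rewrite /re_dot !dotmxE !mxE !raddf_sum; apply: eq_bigr => k _.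
by rewrite !mxE; case: (u 0 k) (v 0 k) => [a b] [c d] /=; ring.
Qed.

Lemma re_dotBB (R : realType) n (u v : 'rV[R[i]]_n) :
  re_dot (u - v) (u - v) = re_dot u u - 2 * re_dot u v + re_dot v v.
Proof.
by rewrite re_dotBl !(re_dotC _ (u - v)) !re_dotBl (re_dotC v u); ring.
Qed.

(** Definiteness of [dotmx] is an inequality in [R[i]], where [x < y] means equal imaginary parts
    and a strict inequality of real parts. *)
Lemma re_dot_gt0 (R : realType) n (u : 'rV[R[i]]_n) :
  u != 0 -> 0 < re_dot u u.
Proof. by move=> /dotmx_is_dotmx; rewrite ltcE => /andP[]. Qed.

(** A nonnegative element of [R[i]] is real. This moves inequalities between [R] and [R[i]]. *)
Lemma dotmxx (R : realType) n (u : 'rV[R[i]]_n) : dotmx u u = (re_dot u u)%:C.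
Proof. by rewrite RRe_real// ger0_real// dnorm_ge0. Qed.

Lemma re_dot_ge0 (R : realType) n (u : 'rV[R[i]]_n) : 0 <= re_dot u u.
Proof. by rewrite -lecR -dotmxx dnorm_ge0. Qed.

Lemma sqr_l2norm (R : realType) n (u : 'rV[R[i]]_n) :
  l2norm u ^+ 2 = re_dot u u.
Proof. by rewrite sqr_sqrtr ?re_dot_ge0. Qed.

Lemma l2norm_neq0 (R : realType) n (u : 'rV[R[i]]_n) :
  u != 0 -> l2norm u != 0.
Proof. by move=> u0; rewrite sqrtr_eq0 -ltNge re_dot_gt0. Qed.

Lemma l2norm_ge0 (R : realType) n (u : 'rV[R[i]]_n) : 0 <= l2norm u.
Proof. exact: sqrtr_ge0. Qed.

Lemma toC_neq0 (R : realType) n (u : 'rV[R]_n) : u != 0 -> toC u != 0.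
Proof. by rewrite map_mx_eq0. Qed.

Lemma normr_re_dot_le (R : realType) n (u v : 'rV[R[i]]_n) :
  `|re_dot u v| <= l2norm u * l2norm v.
Proof.
(* Both sides become square roots, so it suffices to compare the radicands; these are cast to
   [R[i]], where [CauchySchwarz] bounds the squared modulus of [dotmx u v], which is at least the
   square of its real part. *)
rewrite -sqrtrM ?re_dot_ge0// -sqrtr_sqr ler_wsqrtr// -lecR.
rewrite [leRHS]rmorphM /= -!dotmxx; apply: le_trans (CauchySchwarz _ u v).
by rewrite -add_Re2_Im2 lecR lerDl sqr_ge0.
Qed.

Lemma sqr_l2normB (R : realType) n (u v : 'rV[R[i]]_n) :
  l2norm (u - v) ^+ 2 = l2norm u ^+ 2 - 2 * re_dot u v + l2norm v ^+ 2.
Proof. by rewrite [LHS]sqr_l2norm re_dotBB -!sqr_l2norm. Qed.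

(** The nonvanishing hypotheses let the scaling factors cancel the denominators of both
    probabilities; what is left is the expansion of the squared distance. *)
Lemma infinite_shot_lossE (R : realType) n n0 (lambda : R)
    (u0 : 'rV[R[i]]_n0) (uobs : 'rV[R]_n) (ut : 'rV[R[i]]_n) :
  u0 != 0 -> uobs != 0 -> lambda != 0 ->
  infinite_shot_loss lambda u0 uobs ut = l2norm (ut - toC uobs) ^+ 2.
Proof.
move=> /l2norm_neq0 u0n /toC_neq0/l2norm_neq0 uobsn ln.
rewrite /infinite_shot_loss hadamard_probE /succ_prob [RHS]sqr_l2normB (re_dotC ut).
move: (l2norm u0) (l2norm (toC uobs)) u0n uobsn => a b an bn.
by field; rewrite an bn ln.
Qed.

Lemma sqr_l2norm_dist (R : realType) n (u v w : 'rV[R[i]]_n) :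
  `|l2norm (u - w) ^+ 2 - l2norm (v - w) ^+ 2|
    <= 2 * l2norm (u - w) * l2norm (u - v) + l2norm (u - v) ^+ 2.
Proof.
have -> : v - w = (u - w) - (u - v) by rewrite opprB [RHS]addrC addrA subrK.
move: (u - w) (u - v) => a d.
have := normr_re_dot_le a d; have := sqr_l2normB a d.
(* From here on this is an inequality between reals: only the expansion of [c ^+ 2] and the bound of
   [r] by [x * y] are kept. *)
generalize (l2norm (a - d)) (l2norm a) (l2norm d) (re_dot a d) => c x y r -> rxy.
have -> : x ^+ 2 - (x ^+ 2 - 2 * r + y ^+ 2) = 2 * r - y ^+ 2 by ring.
apply: (le_trans (ler_normB _ _)).
rewrite (ger0_norm (sqr_ge0 _)) lerD2r normrM normr_nat -mulrA.
by rewrite ler_pM2l ?ltr0n.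
Qed.

Theorem lemma4p2 (R : realType) (nx n0 : nat) (hnx : (1 <= nx)%N)
    (M : Type) (uT : M -> 'rV[R]_nx) (utilde : M -> 'rV[R[i]]_nx)
    (u0 : 'rV[R[i]]_n0) (uobs : 'rV[R]_nx) (lambda : M -> R) (eps_app : R)
    (m : M)
    (hu0 : u0 != 0) (huobs : uobs != 0)
    (hlambda : 0 < lambda m)
    (hscale : l2norm (utilde m) <= lambda m * l2norm u0)
    (heps : 0 <= eps_app)
    (happ : l2norm (toC (uT m) - utilde m) <= eps_app) :
  `|phys_loss (uT m) uobs - infinite_shot_loss (lambda m) u0 uobs (utilde m)|
    <= 2 * l2norm (toC (uT m) - toC uobs) * eps_app + eps_app ^+ 2
  /\
  (forall delta : R, 0 < delta -> delta < 1 ->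
     l2norm (toC (uT m) - toC uobs) <= delta * l2norm (toC uobs) ->
     `|phys_loss (uT m) uobs - infinite_shot_loss (lambda m) u0 uobs (utilde m)|
       <= 2 * delta * l2norm (toC uobs) * eps_app + eps_app ^+ 2).
Proof.
have main : `|phys_loss (uT m) uobs
      - infinite_shot_loss (lambda m) u0 uobs (utilde m)|
    <= 2 * l2norm (toC (uT m) - toC uobs) * eps_app + eps_app ^+ 2.
  rewrite infinite_shot_lossE ?gt_eqF//.
  (* The bound is nondecreasing in the distance from [uT m] to [utilde m], so [eps_app] may replace
     that distance term by term. *)
  apply: (le_trans (sqr_l2norm_dist _ _ _)); apply: lerD.
    by rewrite ler_wpM2l// mulr_ge0 ?ler0n ?l2norm_ge0.
  by rewrite lerXn2r ?nnegrE ?l2norm_ge0.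
split=> [|delta _ _ hdelta]; first exact: main.
apply: (le_trans main).
rewrite lerD2r -[2 * delta * _]mulrA; apply: ler_wpM2r; first exact: heps.
by apply: ler_wpM2l; [exact: ler0n | exact: hdelta].
Qed.
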